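(* (a) $L(3,3)=2$ and $L(3,4)=3$. (b) For every integer $n\ge 5$, $L(3,n)$ is the greatest integer less than or equal to $(3n-1)/2$.
   Context: Let $m,n$ be integers with $2\le m\le n$. An $m$ by $n$ array consists of $mn$ cells arranged in $m$ rows and $n$ columns, each cell containing exactly one symbol (symbols are arbitrary and may repeat). A transversal of an array consists of $m$ cells, one from each row and no two from the same column. A latin transversal is a transversal in which no symbol appears more than once. $L(m,n)$ denotes the largest integer such that every $m$ by $n$ array in which each symbol appears at most $L(m,n)$ times has a latin transversal. *)

(* Defs.v *)
From mathcomp Require Import all_boot all_order all_algebra.

Set Implicit Arguments.
Unset Strict Implicit.
Unset Printing Implicit Defensive.

(* An m by n array with symbols in T is a matrix A : 'M[T]_(m, n); symbols may
   repeat and T : eqType is arbitrary. *)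

Definition occurrences (T : eqType) (m n : nat) (A : 'M[T]_(m, n)) (s : T) : nat :=
  #|[set c : 'I_m * 'I_n | A c.1 c.2 == s]|.

(* A choice of one cell in each row is a function f from rows to columns, the
   chosen cells being the (i, f i). *)
Definition is_transversal (m n : nat) (f : {ffun 'I_m -> 'I_n}) : Prop :=
  injective f.

Definition is_latin_transversal (T : eqType) (m n : nat) (A : 'M[T]_(m, n))
    (f : {ffun 'I_m -> 'I_n}) : Prop :=
  is_transversal f /\ injective (fun i : 'I_m => A i (f i)).

Definition forces_latin_transversal (m n l : nat) : Prop :=
  forall (T : eqType) (A : 'M[T]_(m, n)),
    (forall s : T, occurrences A s <= l) ->
    exists f : {ffun 'I_m -> 'I_n}, is_latin_transversal A f.

(* L(m, n) = l.  Ranging over nat loses nothing: when 2 <= m <= n the bound 0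
   has the property vacuously, so the largest integer with it is not negative. *)
Definition is_L (m n l : nat) : Prop :=
  forces_latin_transversal m n l /\
  (forall l' : nat, forces_latin_transversal m n l' -> l' <= l).

(* Main.v *)
Require Import Defs.
From mathcomp Require Import all_boot all_order all_algebra.
From mathcomp Require Import zify.

(** Upper bounds come from explicit arrays. A checkerboard on two symbols has
    no three distinct symbols at all, and each of its two symbols fills at most
    half of the [3 * n] cells, rounded up. For three and four columns there are
    better arrays on the symbols 0, 1, 2, in which the sum modulo 3 of the
    symbols on any transversal is nonzero, so that the transversal misses one
    of 0, 1, 2 and repeats another.

    For the lower bounds, suppose that there is no latin transversal and that
    every symbol fills less than half of the [3 * n] cells. Any two rows have
    cells with different symbols in different columns ([distinct_pair]), and
    these force every cell of the third row outside those two columns to carry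
    one of the two symbols. If [n >= 7], this leaves at least five cells for two
    symbols, so each row has a symbol that it contains at least three times
    ([row_has_triple]).

    - If two rows are dominated in this sense by different symbols [a] and [b],
      then the third row contains only [a] and [b], and one of them, say [a],
      at least three times. So two rows are dominated by [a] and contain only
      [a] and [b]. Since [a] and [b] do not fill the array, some cell of the
      row dominated by [b] has a third symbol; then both of the other rows are
      constant, equal to [a], outside the column of that cell, and [a] occurs
      too often ([distinct_dominants]).
    - If all rows are dominated by the same [a], then two cells in different
      rows and columns, neither of them carrying [a], carry the same symbol.
      This again forces a second symbol [b] for which a cell outside [{a, b}]
      makes two rows constant outside one column ([same_dominant]).

    The remaining cases [n = 3, 4, 5, 6] are finite once symbols are named by
    order of first appearance: an exhaustive search fills the array cell by
    cell and abandons a branch as soon as a symbol occurs too often or three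
    cells form a latin transversal. The search is run by computation, and
    [refute_sound] says that it misses no array. *)

Set Implicit Arguments.
Unset Strict Implicit.
Unset Printing Implicit Defensive.

(** * Three rows *)

Lemma uniq3P (E : eqType) (x y z : E) :
  reflect [/\ x != y, x != z & y != z] (uniq [:: x; y; z]).
Proof.
rewrite /= !inE negb_or !andbT.
by apply: (iffP andP) => [[/andP[? ?] ?]|[? ? ?]]; split=> //; apply/andP.
Qed.

Lemma mem_uniq_ord3 (r s t q : 'I_3) : uniq [:: r; s; t] -> q \in [:: r; s; t].
Proof.
move=> /card_uniqP card3; suff -> : [:: r; s; t] =i predT by [].
by apply/subset_cardP; rewrite ?subset_predT // card3 card_ord.
Qed.

Lemma other_row (r s : 'I_3) : r != s -> exists t, uniq [:: r; s; t].
Proof.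
move=> rs; have : 0 < #|~: [set r; s]|.
  by have := cardsC [set r; s]; rewrite cards2 rs card_ord; lia.
case/card_gt0P=> t; rewrite !inE negb_or => /andP[tr ts]; exists t.
by apply/uniq3P; rewrite rs eq_sym tr eq_sym ts.
Qed.

Lemma other_rows (r : 'I_3) : exists s t, uniq [:: r; s; t].
Proof.
have : 0 < #|~: [set r]| by have := cardsC [set r]; rewrite cards1 card_ord; lia.
case/card_gt0P=> s; rewrite !inE => sr.
have [|t rst] := @other_row r s; first by rewrite eq_sym.
by exists s, t.
Qed.

(** No three cells in distinct rows and distinct columns carry three distinct
    symbols. For three rows this says that there is no latin transversal. *)
Definition no_rainbow (T : eqType) (m n : nat) (A : 'M[T]_(m, n)) : Prop :=
  forall (r s t : 'I_m) (i j k : 'I_n),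
    uniq [:: r; s; t] -> uniq [:: i; j; k] -> ~~ uniq [:: A r i; A s j; A t k].

Lemma latin_transversal_or_no_rainbow (T : eqType) (n : nat) (A : 'M[T]_(3, n)) :
  (exists f : {ffun 'I_3 -> 'I_n}, is_latin_transversal A f) \/ no_rainbow A.
Proof.
case: (boolP [exists f : {ffun 'I_3 -> 'I_n},
                injectiveb f && injectiveb (fun i => A i (f i))]) => [|nof].
  by case/existsP=> f /andP[/injectiveP fI /injectiveP AI]; left; exists f.
right=> r s t i j k rst ijk; apply: contra nof => Auniq; apply/existsP.
exists [ffun q => if q == r then i else if q == s then j else k].
have /uniq3P[rs rt st] := rst.
have [sr tr ts] : [/\ (s == r) = false, (t == r) = false & (t == s) = false].
  by rewrite !(eq_sym t) (eq_sym s); split; apply/negbTE.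
have cover q : [\/ q = r, q = s | q = t].
  have := mem_uniq_ord3 q rst; rewrite !inE.
  by case/or3P=> /eqP->; [constructor 1|constructor 2|constructor 3].
case/uniq3P: ijk => ij ik jk; case/uniq3P: Auniq => Aij Aik Ajk.
apply/andP; split; apply/injectiveP=> p q; rewrite !ffunE.
- by case: (cover p) => ->; case: (cover q) => ->; rewrite ?eqxx ?sr ?tr ?ts //;
    move=> /eqP; rewrite ?(eq_sym j i) ?(eq_sym k i) ?(eq_sym k j)
      ?(negbTE ij) ?(negbTE ik) ?(negbTE jk).
- by case: (cover p) => ->; case: (cover q) => ->; rewrite ?eqxx ?sr ?tr ?ts //;
    move=> /eqP; rewrite ?(eq_sym (A s j) (A r i)) ?(eq_sym (A t k) (A r i))
      ?(eq_sym (A t k) (A s j)) ?(negbTE Aij) ?(negbTE Aik) ?(negbTE Ajk).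
Qed.

Lemma occurrences_sum (T : eqType) (m n : nat) (A : 'M[T]_(m, n)) (s : T) :
  occurrences A s = \sum_(r < m) #|[set j | A r j == s]|.
Proof.
rewrite /occurrences -sum1dep_card; under [RHS]eq_bigr do rewrite -sum1dep_card.
by rewrite pair_big_dep.
Qed.

(** * Arrays without latin transversals *)

Lemma is_L_intro (m n l : nat) :
  forces_latin_transversal m n l -> ~ forces_latin_transversal m n l.+1 ->
  is_L m n l.
Proof.
move=> Fl nFl; split=> // l' Fl'; rewrite leqNgt; apply/negP=> ll'; apply: nFl.
by move=> T A occ; apply: Fl' => s; apply: leq_trans (occ s) ll'.
Qed.

(** The rows are 012, 012, 120: the sum modulo 3 on a transversal is 1. *)
Lemma not_forces_3_3 : ~ forces_latin_transversal 3 3 3.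
Proof.
pose A : 'M[nat]_(3, 3) := (\matrix_(i, j) ((j + (val i == 2)) %% 3)%N)%R.
case/(_ _ A) => [s|f [fI AI]].
  rewrite occurrences_sum; apply: (@leq_trans (\sum_(r < 3) 1)).
    2: by rewrite sum1_card card_ord.
  apply: leq_sum => r _.
  apply/card_le1_eqP => i j; rewrite !inE !mxE => /eqP <- /eqP E.
  apply/val_inj => /=.
  have := ltn_ord i; have := ltn_ord j; move: E; case: (_ == _); lia.
pose o0 : 'I_3 := @Ordinal 3 0 isT.
pose o1 : 'I_3 := @Ordinal 3 1 isT.
pose o2 : 'I_3 := @Ordinal 3 2 isT.
have neqf i j : i != j -> (val (f i) != val (f j)) && (A i (f i) != A j (f j)).
  move=> ij; apply/andP; split; apply: contra ij => /eqP E; apply/eqP.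
    exact/fI/val_inj.
  exact: AI.
have := neqf o0 o1 isT; have := neqf o0 o2 isT; have := neqf o1 o2 isT.
rewrite !mxE /=.
have := ltn_ord (f o0); have := ltn_ord (f o1); have := ltn_ord (f o2).
lia.
Qed.

(** The rows are 0011, 1122, 2200: the sum modulo 3 on a transversal is the number
    of cells chosen in the last two columns, which is 1 or 2. *)
Lemma not_forces_3_4 : ~ forces_latin_transversal 3 4 4.
Proof.
pose A : 'M[nat]_(3, 4) := (\matrix_(i, j) ((i + (2 <= j)) %% 3)%N)%R.
case/(_ _ A) => [s|f [fI AI]].
  rewrite /occurrences; case: (ltnP s 3) => hs.
    rewrite -sum1dep_card.
    rewrite -(pair_big_dep predT (fun i j => A i j == s) (fun _ _ => 1)) /=.
    rewrite !big_mkcond /=; under eq_bigr do rewrite big_mkcond /=.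
    rewrite !big_ord_recl !big_ord0 !mxE /=.
    by case: s hs => [|[|[|s]]].
  rewrite (_ : [set _ | _] = set0) ?cards0 //; apply/setP=> c; rewrite !inE mxE.
  by apply/negbTE; lia.
pose o0 : 'I_3 := @Ordinal 3 0 isT.
pose o1 : 'I_3 := @Ordinal 3 1 isT.
pose o2 : 'I_3 := @Ordinal 3 2 isT.
have neqf i j : i != j -> (val (f i) != val (f j)) && (A i (f i) != A j (f j)).
  move=> ij; apply/andP; split; apply: contra ij => /eqP E; apply/eqP.
    exact/fI/val_inj.
  exact: AI.
have := neqf o0 o1 isT; have := neqf o0 o2 isT; have := neqf o1 o2 isT.
rewrite !mxE /=.
have := ltn_ord (f o0); have := ltn_ord (f o1); have := ltn_ord (f o2).
lia.
Qed.

Lemma not_forces_checkerboard (n l : nat) :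
  3 * n <= 2 * l -> ~ forces_latin_transversal 3 n l.
Proof.
move=> nl; pose A : 'M[bool]_(3, n) := (\matrix_(i, j) odd (i + j)%N)%R.
case/(_ _ A) => [s|f [_ AI]]; last first.
  by have := leq_card _ AI; rewrite card_ord card_bool.
have row b : \sum_(j < n) (odd j == b) = if b then n./2 else uphalf n.
  elim: n {nl A} b => [|n IH] b; first by rewrite big_ord0; case: b.
  by rewrite big_ord_recr /= IH; case: b; lia.
rewrite occurrences_sum !big_ord_recl big_ord0.
have rowA r : #|[set j | A r j == s]| = \sum_(j < n) (odd j == odd r (+) s).
  rewrite -sum1dep_card big_mkcond; apply: eq_bigr => j _.
  by rewrite mxE oddD; case: s; case: (odd r); case: (odd j).
by rewrite !rowA /= !row; case: (s) => /=; lia.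
Qed.

(** * Exhaustive search for few columns *)

(** Row, column and code of the symbol. *)
Definition cell := (nat * nat * nat)%type.

(** Two cells differ in symbol, row and column. The nested conditionals, here
    and in [refute], stop the evaluation early under call by value. *)
Definition compatible (x y : cell) : bool :=
  if x.2 == y.2 then false else
  if x.1.1 == y.1.1 then false else x.1.2 != y.1.2.

(** The cell [x] forms a latin transversal with two cells of [s]. *)
Definition completes (x : cell) (s : seq cell) : bool :=
  let s' := filter (compatible x) s in
  has (fun y => has (compatible y) s') s'.

(** Exhaustive search: [s] lists the cells filled so far, latest first, and
    [todo] the positions left. The symbol of the next cell is either one that
    occurs in [s] or a new one, whose code is the number of cells filled so far.
    The answer [true] means that every way to fill [todo] produces a symbol with
    more than [l] occurrences or a latin transversal. *)
Fixpoint refute (l : nat) (todo : seq (nat * nat)) (s : seq cell) : bool :=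
  if todo is p :: todo' then
    all (fun v =>
           if l <= count (fun y => y.2 == v) s then true else
           if completes (p, v) s then true else
           refute l todo' ((p, v) :: s))
        (size s :: undup [seq y.2 | y <- s])
  else false.

Section Soundness.

Variables (T : eqType) (m n l : nat) (A : 'M[T]_(m, n)).
Variable cells : seq ('I_m * 'I_n).
Hypothesis cells_uniq : uniq cells.
Hypothesis occ_le : forall s : T, occurrences A s <= l.
Hypothesis noR : no_rainbow A.

Let sym (c : 'I_m * 'I_n) : T := A c.1 c.2.
(* The rank, in the order of [cells], of the first cell with the same symbol. *)
Let code (c : 'I_m * 'I_n) : nat := index (sym c) (map sym cells).
Let pos (c : 'I_m * 'I_n) : nat * nat := (val c.1, val c.2).
Let tag (c : 'I_m * 'I_n) : cell := (pos c, code c).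

Lemma code_eq c d : c \in cells -> (code d == code c) = (sym d == sym c).
Proof.
move=> cin; apply/eqP/eqP => [E|]; last by rewrite /code => ->.
have cw : sym c \in map sym cells by apply: map_f.
have dw : sym d \in map sym cells by rewrite -index_mem -/(code d) E index_mem.
by rewrite -(nth_index (sym c) dw) -/(code d) E nth_index.
Qed.

Lemma compatible_tag c d : d \in cells ->
  compatible (tag c) (tag d) = [&& sym c != sym d, c.1 != d.1 & c.2 != d.2].
Proof.
move=> din; rewrite /compatible /= code_eq //.
rewrite -[c.1 == d.1](inj_eq val_inj) -[c.2 == d.2](inj_eq val_inj).
by case: (sym c == sym d); case: (val c.1 == val d.1).
Qed.

Lemma completes_tag c (s : seq ('I_m * 'I_n)) :
  {subset s <= cells} -> completes (tag c) (map tag s) = false.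
Proof.
move=> scells; apply/negP=> /hasP[x]; rewrite mem_filter => /andP[cx].
case/mapP=> d ds dx; subst x.
case/hasP=> y; rewrite mem_filter => /andP[cy] /mapP[e es ey]; subst y => de.
move: cx cy de; rewrite !compatible_tag ?scells //.
case/and3P=> scd rcd kcd /and3P[sce rce kce] /and3P[sde rde kde].
have := @noR c.1 d.1 e.1 c.2 d.2 e.2.
by rewrite !(introT (uniq3P _ _ _)) // => /(_ isT isT).
Qed.

Lemma count_cells_le (s : T) : count (fun c => sym c == s) cells <= l.
Proof.
apply: leq_trans (occ_le s); rewrite -size_filter /occurrences cardE.
apply: uniq_leq_size; first exact: filter_uniq.
by move=> c; rewrite mem_filter mem_enum inE => /andP[].
Qed.

(** The array [A] itself is a branch on which the search does not succeed. *)
Lemma refute_sound (todo done : seq ('I_m * 'I_n)) :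
  cells = rev done ++ todo -> refute l (map pos todo) (map tag done) = false.
Proof.
elim: todo done => [//|c todo IH] done Ecells.
have dc : {subset done <= cells}.
  by move=> d dd; rewrite Ecells mem_cat mem_rev dd.
have cc : c \in cells by rewrite Ecells mem_cat inE eqxx orbT.
apply/negbTE/allPn; exists (code c).
- rewrite size_map inE mem_undup; case: (boolP (sym c \in map sym done)).
    case/mapP=> d dd E; apply/orP; right; rewrite -map_comp.
    by apply/mapP; exists d => //=; apply/eqP; rewrite code_eq ?E //; apply: dc.
  move=> cnd; rewrite /code Ecells map_cat index_cat map_rev mem_rev.
  by rewrite (negbTE cnd) /= eqxx addn0 size_rev size_map eqxx.
- rewrite count_map leqNgt.
  have -> : count (preim tag (fun y => y.2 == code c)) done < l.
    apply: leq_trans (count_cells_le (sym c)).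
    rewrite Ecells count_cat count_rev /= eqxx addnCA -addn1 addnC leq_add2l.
    apply: leq_trans (leq_addr _ _); rewrite leq_eqVlt; apply/orP; left.
    by apply/eqP/eq_in_count=> d dd /=; rewrite code_eq.
  rewrite completes_tag //=; apply/negbT/(IH (c :: done)).
  by rewrite Ecells rev_cons cat_rcons.
Qed.

End Soundness.

(** The positions of an array, column by column. *)
Definition grid (m n : nat) : seq (nat * nat) :=
  [seq (i, j) | j <- iota 0 n, i <- iota 0 m].

Lemma forces_of_refute (n l : nat) :
  refute l (grid 3 n) [::] -> forces_latin_transversal 3 n l.
Proof.
move=> ref T A occ_le; case: (latin_transversal_or_no_rainbow A) => // noR.
pose cells := [seq (i, j) | j <- enum 'I_n, i <- enum 'I_3].
have cells_uniq : uniq cells.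
  by apply: allpairs_uniq; rewrite ?enum_uniq // => -[a b] [c d] _ _ [-> ->].
have := refute_sound cells_uniq occ_le noR (erefl : cells = rev [::] ++ cells).
suff -> : [seq (val c.1, val c.2) | c <- cells] = grid 3 n by rewrite ref.
rewrite /grid -!val_enum_ord map_allpairs allpairs_mapl.
by rewrite allpairs_mapr.
Qed.

Lemma forces_small (n l : nat) : (n, l) \in [:: (3, 2); (4, 3); (5, 7); (6, 8)] ->
  forces_latin_transversal 3 n l.
Proof.
by rewrite !inE => /or4P[] /eqP[-> ->]; apply: forces_of_refute; vm_compute.
Qed.

(** * Many columns *)

Section LargeArrays.

Variables (T : eqType) (n : nat) (A : 'M[T]_(3, n)).
Hypothesis n_ge5 : 5 <= n.
Hypothesis occ_lt : forall s : T, 2 * occurrences A s < 3 * n.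
Hypothesis noR : no_rainbow A.

Implicit Types (r s t : 'I_3) (i j k : 'I_n) (a b c x y : T).

(* The number of cells of row [r] that carry [x]. *)
Let row_count r x : nat := #|[set j | A r j == x]|.

Lemma occ_rows r s t x : uniq [:: r; s; t] ->
  occurrences A x = row_count r x + row_count s x + row_count t x.
Proof.
move=> rst; have /uniq3P[rs rt st] := rst.
rewrite occurrences_sum (bigD1 r) //= (bigD1 s) 1?eq_sym //=.
rewrite (bigD1 t) /= ?big1 ?addn0 ?addnA //; last by rewrite eq_sym rt eq_sym st.
move=> q /andP[/andP[qr qs] qt]; have := mem_uniq_ord3 q rst.
by rewrite !inE (negbTE qr) (negbTE qs) (negbTE qt).
Qed.

(** A property of more than [size js] cells of a row holds outside the columns
    [js]. *)
Lemma row_pick r (P : {pred T}) (js : seq 'I_n) :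
  size js < #|[set j | P (A r j)]| -> exists2 j, j \notin js & P (A r j).
Proof.
move=> H; have : 0 < #|[set j | P (A r j)] :\: [set j in js]|.
  have := cardsID [set j in js] [set j | P (A r j)].
  have : #|[set j | P (A r j)] :&: [set j in js]| <= size js.
    apply: leq_trans (card_size js); apply: subset_leq_card.
    by apply/subsetP=> j; rewrite !inE => /andP[].
  lia.
by case/card_gt0P=> j; rewrite !inE => /andP[jj Pj]; exists j.
Qed.

Lemma row_countC r x : row_count r x + #|[set j | A r j != x]| = n.
Proof.
rewrite -[RHS](card_ord n) -(cardsC [set j | A r j == x]); congr (_ + _).
by apply: eq_card => j; rewrite !inE.
Qed.

(** Otherwise [a] would occur at least [2 * (n - 1)] times. *)
Lemma two_rows_not_constant r s k a : r != s ->
  ~ (forall j, j != k -> A r j = a /\ A s j = a).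
Proof.
move=> rs H; have [t rst] := other_row rs.
have := occ_lt a; rewrite (occ_rows a rst).
have big q : (forall j, j != k -> A q j = a) -> n <= row_count q a + 1.
  move=> Hq; rewrite -{1}(row_countC q a) leq_add2l -[X in _ <= X](cards1 k).
  apply: subset_leq_card; apply/subsetP=> j; rewrite !inE; apply: contraR.
  by move=> /Hq ->.
have := big r (fun j jk => proj1 (H j jk)).
have := big s (fun j jk => proj2 (H j jk)).
lia.
Qed.

(** Two symbols cannot fill the [3 * n] cells. *)
Lemma third_symbol a b : exists r k, A r k != a /\ A r k != b.
Proof.
case: (boolP [exists r, exists k, (A r k != a) && (A r k != b)]).
  by case/existsP=> r /existsP[k /andP[? ?]]; exists r, k.
move=> H; exfalso; have [s [t rst]] := other_rows ord0.
have := occ_lt a; have := occ_lt b; rewrite !(occ_rows _ rst).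
have R r : n <= row_count r a + row_count r b.
  rewrite -{1}(row_countC r a) leq_add2l; apply: subset_leq_card.
  apply/subsetP=> k; rewrite !inE; apply: contraR => kb.
  move: H; rewrite negb_exists => /forallP/(_ r); rewrite negb_exists.
  by move=> /forallP/(_ k); rewrite kb andbT negbK => /eqP->.
have := R ord0; have := R s; have := R t; lia.
Qed.

Lemma distinct_pair r s : r != s -> exists i j, i != j /\ A r i != A s j.
Proof.
move=> rs.
case: (boolP [exists i, exists j, (i != j) && (A r i != A s j)]).
  by case/existsP=> i /existsP[j /andP[? ?]]; exists i, j.
rewrite negb_exists => /forallP H; exfalso.
have E i j : i != j -> A r i = A s j.
  move=> ij; have := H i; rewrite negb_exists => /forallP/(_ j).
  by rewrite ij /= negbK => /eqP.
have n_gt0 : 0 < n by lia.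
have n_gt1 : 1 < n by lia.
pose o0 := Ordinal n_gt0; pose o1 := Ordinal n_gt1.
(* The constant is the symbol [A s o0]; where row [s] is concerned, the equality
   passes through row [r] in a column [k] other than [j] and [o0]. *)
apply: (@two_rows_not_constant r s o0 (A s o0) rs) => j jo; split.
  exact: E.
have n_gt2 : 2 < n by lia.
pose o2 := Ordinal n_gt2.
have [k /andP[kj ko]] : exists k, (k != j) && (k != o0).
  by case: (eqVneq o1 j) => [<-|]; [exists o2|exists o1; apply/andP].
by rewrite -(E k j kj) (E k o0 ko).
Qed.

(** The cells of row [r] outside the two columns given by [distinct_pair] for the
    other rows, at least five of them, carry only two symbols. *)
Lemma row_has_triple r : 7 <= n -> exists a, 3 <= row_count r a.
Proof.
move=> n_ge7; have [s [t rst]] := other_rows r.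
have st : s != t by move: rst => /= /and3P[_]; rewrite inE.
have [i [j [ij Aij]]] := distinct_pair st.
suff : n <= row_count r (A s i) + row_count r (A t j) + 2.
  by case: (leqP 3 (row_count r (A s i))) => ? ?;
    [exists (A s i)|exists (A t j)]; lia.
rewrite -{1}(row_countC r (A s i)) -addnA leq_add2l.
have -> : row_count r (A t j) + 2 = row_count r (A t j) + #|[set i; j]|.
  by rewrite cards2 ij.
rewrite -cardsUI; apply: leq_trans (leq_addr _ _); apply: subset_leq_card.
apply/subsetP=> k; rewrite !inE => ki; apply: contraT.
rewrite !negb_or => /andP[kj /andP[nki nkj]].
have := @noR r s t k i j rst; rewrite /= !inE !negb_or nki nkj ij Aij ki kj.
by move=> /(_ isT).
Qed.

Lemma no_rainbow_triple r s t i j k : uniq [:: r; s; t] -> uniq [:: i; j; k] ->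
  [\/ A r i = A s j, A r i = A t k | A s j = A t k].
Proof.
move=> rst ijk; have := noR rst ijk.
case: (eqVneq (A r i) (A s j)) => [?|a1]; first by constructor 1.
case: (eqVneq (A r i) (A t k)) => [?|a2]; first by constructor 2.
case: (eqVneq (A s j) (A t k)) => [?|a3]; first by constructor 3.
by rewrite (introT (uniq3P _ _ _) _).
Qed.

Lemma third_row_subset r s t a b k : uniq [:: r; s; t] -> a != b ->
  3 <= row_count r a -> 3 <= row_count s b -> A t k = a \/ A t k = b.
Proof.
move=> rst ab ra sb.
have [|i ik /eqP Ai] := @row_pick r (pred1 a) [:: k]; first exact: leq_trans ra.
have [|j jk /eqP Aj] := @row_pick s (pred1 b) [:: i; k]; first exact: leq_trans sb.
have ijk : uniq [:: i; j; k].
  by move: ik jk; rewrite /= !inE !negb_or andbT => -> /andP[ji ->]; rewrite eq_sym ji.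
case: (no_rainbow_triple rst ijk); rewrite ?Ai ?Aj => E.
- by rewrite E eqxx in ab.
- by left.
- by right.
Qed.

(** The configuration that [distinct_dominants] leads to, up to exchanging the
    roles of [a] and [b]. *)
Lemma distinct_dominants_aux r s t a b : uniq [:: r; s; t] -> a != b ->
  3 <= row_count r a -> 3 <= row_count s b -> 3 <= row_count t a -> False.
Proof.
move=> rst ab ra sb ta; have /uniq3P[rs rt st] := rst.
have rts : uniq [:: t; s; r] by apply/uniq3P; rewrite !(eq_sym t) (eq_sym s r).
have tE k := third_row_subset k rst ab ra sb.
have rE k := third_row_subset k rts ab ta sb.
(* A cell with a third symbol; it lies in row [s]. *)
have [q [k [ca cb]]] := third_symbol a b.
have qs : q = s.
  have := mem_uniq_ord3 q rst; rewrite !inE => /or3P[] /eqP // qE.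
    by case: (rE k) => E; move: ca cb; rewrite qE E eqxx.
  by case: (tE k) => E; move: ca cb; rewrite qE E eqxx.
rewrite {}qs in ca cb.
apply: (@two_rows_not_constant r t k a rt) => j jk; split.
- have [|i ij /eqP Ai] := @row_pick t (pred1 a) [:: j; k]; first exact: ta.
  case: (rE j) => // rj; exfalso.
  have jki : uniq [:: j; k; i].
    move: ij; rewrite !inE negb_or => /andP[ij ik].
    by apply/uniq3P; rewrite jk eq_sym ij eq_sym ik.
  case: (no_rainbow_triple rst jki); rewrite ?rj ?Ai => E.
  + by rewrite E eqxx in cb.
  + by rewrite E eqxx in ab.
  + by rewrite E eqxx in ca.
- have [|i ij /eqP Ai] := @row_pick r (pred1 a) [:: j; k]; first exact: ra.
  case: (tE j) => // tj; exfalso.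
  have ikj : uniq [:: i; k; j].
    move: ij; rewrite !inE negb_or => /andP[ij ik].
    by apply/uniq3P; rewrite ij ik eq_sym jk.
  case: (no_rainbow_triple rst ikj); rewrite ?tj ?Ai => E.
  + by rewrite -E eqxx in ca.
  + by rewrite E eqxx in ab.
  + by rewrite E eqxx in cb.
Qed.

Lemma distinct_dominants r s a b : r != s -> a != b ->
  3 <= row_count r a -> 3 <= row_count s b -> False.
Proof.
move=> rs ab ra sb; have [t rst] := other_row rs.
have /uniq3P[_ rt st] := rst.
suff : 3 <= row_count t a \/ 3 <= row_count t b.
  case=> tx; first exact: distinct_dominants_aux rst ab ra sb tx.
  apply: (@distinct_dominants_aux s r t b a) => //; last by rewrite eq_sym.
  by apply/uniq3P; rewrite eq_sym.
suff : n <= row_count t a + row_count t b by lia.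
rewrite -{1}(row_countC t a) leq_add2l; apply: subset_leq_card.
apply/subsetP=> k; rewrite !inE => ka.
by case: (third_row_subset k rst ab ra sb) => /eqP; rewrite ?(negbTE ka).
Qed.

Lemma same_dominant a : (forall r, 3 <= row_count r a) -> False.
Proof.
move=> dom.
(* Otherwise a cell of the remaining row with symbol [a] would complete a latin
   transversal. *)
have pair r s i j : r != s -> i != j ->
    A r i != a -> A s j != a -> A r i = A s j.
  move=> rs ij ri sj; have [t rst] := other_row rs.
  have [|k kij /eqP Ak] := @row_pick t (pred1 a) [:: i; j]; first exact: dom.
  have ijk : uniq [:: i; j; k].
    move: kij; rewrite !inE negb_or => /andP[ki kj].
    by apply/uniq3P; rewrite ij eq_sym ki eq_sym kj.
  case: (no_rainbow_triple rst ijk); rewrite ?Ak // => E.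
  - by rewrite E eqxx in ri.
  - by rewrite E eqxx in sj.
have [r r3] : exists r, 3 <= #|[set j | A r j != a]|.
  apply/existsP; apply: contraT; rewrite negb_exists => /forallP H.
  have [s [t rst]] := other_rows ord0.
  have := occ_lt a; rewrite (occ_rows _ rst).
  have := row_countC ord0 a; have := row_countC s a; have := row_countC t a.
  have := H ord0; have := H s; have := H t; lia.
have [s [t rst]] := other_rows r; have /uniq3P[rs rt st] := rst.
(* If the rows [s] and [t] were both constant, equal to [a], then [a] would occur
   too often. *)
wlog [j sj] : s t rst rs rt st / exists j, A s j != a.
  move=> W; case: (boolP [exists j, A s j != a]) => [/existsP|Hs].
    exact: W rst rs rt st.
  case: (boolP [exists j, A t j != a]) => [/existsP|Ht].
    by apply: (W t s) => //; [apply/uniq3P; split|]; rewrite // eq_sym.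
  have n_gt0 : 0 < n by lia.
  apply: (@two_rows_not_constant s t (Ordinal n_gt0) a st) => j _.
  move: Hs Ht; rewrite !negb_exists => /forallP/(_ j) /negPn/eqP Hs.
  by move=> /forallP/(_ j) /negPn/eqP.
pose b := A s j.
have rb i : i != j -> A r i != a -> A r i = b by move=> ij ri; apply: pair.
have qb q k : q != r -> A q k != a -> A q k = b.
  move=> qr qk; have [|i ijk ri] := @row_pick r (predC1 a) [:: j; k]; first exact: r3.
  move: ijk; rewrite !inE negb_or => /andP[ij ik].
  by rewrite -(rb i ij ri); apply: pair => //; rewrite eq_sym.
(* The only cell that can carry a third symbol is the one in row [r], column
   [j]. *)
have [q [k [ca cb]]] := third_symbol a b.
have qr : q = r.
  by apply/eqP; apply: contraR cb => /qb/(_ ca)/eqP.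
have kj : k = j.
  by apply/eqP; apply: contraR cb => kj; rewrite qr rb // -qr.
rewrite {}qr {}kj in ca cb.
have other p i : p != r -> i != j -> A p i = a.
  move=> pr ij; apply/eqP; apply: contraR cb => pi; apply/eqP.
  by rewrite -(qb p i pr pi); apply: pair; rewrite // eq_sym.
apply: (@two_rows_not_constant s t j a st) => i ij.
by split; apply: other; rewrite // eq_sym.
Qed.

Lemma rainbow_large : 7 <= n -> False.
Proof.
move=> n_ge7; have [a ra] := row_has_triple ord0 n_ge7.
apply: (@same_dominant a) => r; have [b rb] := row_has_triple r n_ge7.
case: (eqVneq a b) => [->//|ab]; case: (eqVneq ord0 r) => [<-//|r0].
by case: (distinct_dominants r0 ab ra rb).
Qed.

End LargeArrays.

Lemma forces_large (n l : nat) : 7 <= n -> 2 * l < 3 * n ->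
  forces_latin_transversal 3 n l.
Proof.
move=> n_ge7 ln T A occ_le.
case: (latin_transversal_or_no_rainbow A) => // noR; exfalso.
have n_ge5 : 5 <= n by lia.
have occ_lt s : 2 * occurrences A s < 3 * n by have := occ_le s; lia.
exact: rainbow_large n_ge5 occ_lt noR n_ge7.
Qed.

Theorem theorem3 :
  (is_L 3 3 2 /\ is_L 3 4 3) /\
  (forall n : nat, 5 <= n -> is_L 3 n ((3 * n - 1) %/ 2)).
Proof.
split; first split.
- by apply: is_L_intro not_forces_3_3; apply: forces_small.
- by apply: is_L_intro not_forces_3_4; apply: forces_small.
- move=> n n_ge5; apply: is_L_intro; last by apply: not_forces_checkerboard; lia.
  case: (ltnP n 7) => [n_lt7|n_ge7]; last by apply: forces_large => //; lia.
  by case: n n_ge5 n_lt7 => [|[|[|[|[|[|[|n]]]]]]] // _ _; apply: forces_small.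
Qed.
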